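(* The nilpotent monoid $M(asabtb)$ is finitely related.
   Context: An operation $f:A^n\to A$ preserves a relation $R\subseteq A^k$ if $f(r_1,\dots,r_n)\in R$ for all $r_1,\dots,r_n\in R$, with $f$ applied coordinatewise. An algebra $\mathbf{A}$ with universe $A$ is finitely related if there is a finite set of finitary relations on $A$ such that the finitary operations on $A$ preserving all of those relations are precisely the term functions of $\mathbf{A}$. Semigroups and monoids are regarded as algebras with a single binary operation; the $n$-ary term functions are those induced by words in $n$ variables. For a word $\mathbf{w}$ in a free monoid $A^*$, $M(\mathbf{w})$ is the Rees quotient of $A^*$ by the ideal of all words that are not subwords (contiguous factors) of $\mathbf{w}$. Thus the elements of $M(\mathbf{w})$ are $0$ and all subwords (including the empty word, which is the identity) of $\mathbf{w}$, and $u\cdot v=uv$ if $uv$ is a subword of $\mathbf{w}$, and $u\cdot v=0$ otherwise. Here $a,b,s,t$ are distinct letters and $asabtb$ is a word of length $6$. *)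

(* Defs.v *)
From HB Require Import structures.
From mathcomp Require Import all_boot.

Set Implicit Arguments.
Unset Strict Implicit.
Unset Printing Implicit Defensive.

Local Open Scope group_scope.

Definition operation (A : Type) (n : nat) := n.-tuple A -> A.

Definition finitary_relation (A : Type) (k : nat) := k.-tuple A -> Prop.

(* The i-th row of r is the element r_i of R; f is applied to each column. *)
Definition preserves (A : Type) (n k : nat) (f : operation A n)
    (R : finitary_relation A k) : Prop :=
  forall r : n.-tuple (k.-tuple A),
    (forall i : 'I_n, R (tnth r i)) ->
    R [tuple f [tuple tnth (tnth r i) j | i < n] | j < k].

(* The value at x of the nonempty word with first letter i and remaining
   letters w. Words are nonempty because the signature has no constant, even
   when the semigroup has an identity. *)
Definition word_eval (S : semigroupType) (n : nat) (i : 'I_n) (w : seq 'I_n)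
    (x : n.-tuple S) : S :=
  foldl (fun y j => y * tnth x j) (tnth x i) w.

Definition term_function (S : semigroupType) (n : nat) (f : operation S n) :=
  exists (i : 'I_n) (w : seq 'I_n), f =1 word_eval i w.

(* Operations have positive arity: there are no nullary terms. *)
Definition finitely_related (S : semigroupType) : Prop :=
  exists (m : nat) (k : 'I_m -> nat)
         (R : forall l : 'I_m, finitary_relation S (k l)),
    forall (n : nat) (f : operation S n), (0 < n)%N ->
      (forall l : 'I_m, preserves f (R l)) <-> term_function f.

(* M(w), with seq T as the free monoid over T: Some u is a factor u of w and
   None is the zero. *)
Definition factor_monoid (T : choiceType) (w : seq T) : Type :=
  option {u : seq T | infix u w}.

HB.instance Definition _ (T : choiceType) (w : seq T) :=
  Choice.on (factor_monoid w).

Section FactorMonoid.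

Variables (T : choiceType) (w : seq T).
Implicit Types x y z : factor_monoid w.

Definition factor_proj (u : seq T) : factor_monoid w := insub u.

Definition factor_mul x y : factor_monoid w :=
  if x is Some u then if y is Some v then factor_proj (val u ++ val v)
  else None else None.

Definition factor_one : factor_monoid w := factor_proj [::].

Lemma factor_proj_val (u : {u : seq T | infix u w}) :
  factor_proj (val u) = Some u.
Proof. exact: valK. Qed.

Lemma factor_proj_surj x : x = None \/ exists u, x = factor_proj u.
Proof.
by case: x => [u|]; [right; exists (val u); rewrite factor_proj_val | left].
Qed.

Lemma factor_projM u v :
  factor_proj (u ++ v) = factor_mul (factor_proj u) (factor_proj v).
Proof.
rewrite /factor_mul {2 3}/factor_proj.
case: insubP => [u' _ -> | nu].
  case: insubP => [v' _ -> // | nv].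
  by apply: insubN; apply: contra nv; apply: catl_infix.
by apply: insubN; apply: contra nu; apply: catr_infix.
Qed.

(* The kernel of factor_proj is the Rees congruence of the ideal of nonfactors
   of w. *)
Lemma factor_proj_eq u v :
  factor_proj u = factor_proj v <->
  u = v \/ (~~ infix u w /\ ~~ infix v w).
Proof.
split=> [|[-> // | [nu nv]]]; last by rewrite /factor_proj !insubN.
rewrite /factor_proj; case: insubP => [u' _ <- | nu].
  by case: insubP => [v' _ <- [->] | //]; left.
by case: insubP => [// | nv _]; right.
Qed.

Lemma factor_mulA : associative factor_mul.
Proof.
have mul0 x : factor_mul x None = None by case: x.
move=> x y z.
have [->|[u ->]] := factor_proj_surj x; first by [].
have [->|[v ->]] := factor_proj_surj y; first by rewrite !mul0.
have [->|[t ->]] := factor_proj_surj z; first by rewrite !mul0.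
by rewrite -!factor_projM catA.
Qed.

Lemma factor_mul1l : left_id factor_one factor_mul.
Proof.
move=> x; have [->|[u ->]] := factor_proj_surj x.
  by rewrite /factor_mul; case: factor_one.
by rewrite -factor_projM.
Qed.

Lemma factor_mulr1 : right_id factor_one factor_mul.
Proof.
move=> x; have [->|[u ->]] := factor_proj_surj x; first by [].
by rewrite -factor_projM cats0.
Qed.

HB.instance Definition _ :=
  isMonoid.Build (factor_monoid w) factor_mulA factor_mul1l factor_mulr1.

End FactorMonoid.

(* Main.v *)
Require Import Defs.
From mathcomp Require Import all_boot.
From mathcomp Require Import zify.

Set Implicit Arguments.
Unset Strict Implicit.
Unset Printing Implicit Defensive.

(** Let W be the word asabtb. The proof rests on a local criterion
    ([local_finitely_related]): a finite semigroup is finitely related if, for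
    some k, an operation that agrees with a term on every k points is itself a
    term. So let f agree with a term on any list of boundedly many points. The
    words that induce f locally have to be glued to one word that induces f.

    First, what M(W) sees of a word w. Suppose that w does not vanish at a
    point x, and delete from w the letters with value 1. The concatenation of
    the values is a factor of W, so that every letter occurs at most twice, and
    a letter that occurs twice is sent to a or to b. As neither aa nor bb is a
    factor of W, the occurrences are separated by a single letter, which occurs
    only once ([factor_twice]). Call a letter linear if it occurs once, and
    separated if it occurs twice with a linear letter in between. Every other
    letter makes the value 0 unless it is sent to 1. Number the occurrences of
    each letter and call the pairs (letter, rank) tokens. Two consecutive
    tokens of a word that does not vanish are never the first occurrences, nor
    the second occurrences, of two separated letters ([visible_in_tokens]). So
    the function induced by w depends only on its content, on which letters
    are linear or separated, and on the order of the visible pairs of tokens: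
    those with different ranks or with a linear member.

    All of this can be read off from f at points with at most four coordinates
    different from 1, because a word is linear in z, or has the form xz, xzx or
    xzxyz'y after deletion of the other letters, exactly when its value at a
    suitable point is a given nonzero factor of W ([value_letter_point]). This
    defines a relation [ahead] between the tokens of f. Any six tokens are
    placed by a word that agrees with f locally in such a way that [ahead] is
    the order of the visible pairs among them ([local_ahead]). As a relation on
    all tokens, [ahead] need not be transitive, but a path of at most four
    steps can be shortened to at most two: if the ends p and q of the path are
    not visible to each other, they have equal rank and belong to separated
    letters, and so the second token r of the path, being visible from p, is
    visible from q, and p, r, q is a path ([ahead_path]). Therefore being at
    most two steps ahead is a strict partial order. A linear extension is the
    list of tokens of a word, to which the remaining letters of the content are
    appended three times, so that they annihilate ([full_word]).

    This word induces f ([full_word_value]). At a point where more than six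
    letters of the content differ from 1 both values are 0. Otherwise, compare
    it with a word that agrees with f at this point and places the tokens of
    those letters correctly: if one of the two words does not vanish, its
    consecutive tokens are visible pairs, and both words coincide after
    deletion of the letters with value 1 ([conforms_glued]). *)

(** * A local criterion for being finitely related *)

Section Local.
Local Open Scope group_scope.
Variable S : semigroupType.

Definition locally_term n k (f : operation S n) :=
  forall P : seq (n.-tuple S), size P <= k ->
  exists i w, forall x, x \in P -> f x = word_eval i w x.

(** The subalgebra of the k-th power of S generated by B. *)
Inductive generated k (B : k.-tuple S -> Prop) : k.-tuple S -> Prop :=
| generated_base v : B v -> generated B v
| generated_mul u v : generated B u -> generated B v ->
    generated B [tuple tnth u j * tnth v j | j < k].

Lemma word_eval_cat n (i j : 'I_n) u v (x : n.-tuple S) :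
  word_eval i (u ++ j :: v) x = word_eval i u x * word_eval j v x.
Proof.
rewrite /word_eval foldl_cat /=; move: (foldl _ _ u) => y.
elim/last_ind: v => [|v l IHv] //=.
by rewrite !foldl_rcons IHv mulgA.
Qed.

Lemma generated_preserved k (B : k.-tuple S -> Prop) n (f : operation S n) :
  term_function f -> preserves f (generated B).
Proof.
case=> i [w fE] r Br.
rewrite (_ : [tuple _ | j < k] =
    [tuple word_eval i w [tuple tnth (tnth r i) j | i < n] | j < k]); last first.
  by apply: eq_from_tnth => j; rewrite !tnth_mktuple fE.
elim/last_ind: w {f fE} => [|w l IHw].
  rewrite (_ : mktuple _ = tnth r i) //.
  by apply: eq_from_tnth => j; rewrite !tnth_mktuple /word_eval /= tnth_mktuple.
rewrite (_ : mktuple _ = [tuple tnth [tuple word_eval i w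
    [tuple tnth (tnth r i) j | i < n] | j < k] j * tnth (tnth r l) j | j < k]).
  exact: generated_mul.
apply: eq_from_tnth => j; rewrite !tnth_mktuple /word_eval foldl_rcons.
by congr (_ * _); rewrite tnth_mktuple.
Qed.

(** Stated for generators that are the rows of a matrix with columns P j: the
    generated subalgebra then consists of the tuples of values of one term at
    all the columns. *)
Lemma generated_word_eval k (B : k.-tuple S -> Prop) n
    (P : 'I_k -> n.-tuple S) v :
    (forall u, B u -> exists i, forall j, tnth u j = tnth (P j) i) ->
  generated B v -> exists i w, forall j, tnth v j = word_eval i w (P j).
Proof.
move=> B_P; elim=> {v} [u /B_P[i uE]|u v _ [i [w uE]] _ [i' [w' vE]]].
  by exists i, [::].
by exists i, (w ++ i' :: w') => j; rewrite tnth_mktuple word_eval_cat uE vE.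
Qed.

(** The defining relations are those generated by the sets of k-tuples. For k
    given points, the rows of the matrix with these points as columns generate
    one of them; if f preserves it, then the tuple of values of f at the points
    belongs to it, that is, comes from a term. Tuples over the ranks of the
    elements in the list e replace tuples over S, so that their sets are
    finitely many. *)
Lemma local_finitely_related (e : seq S) k : (forall x, x \in e) ->
  (forall n (f : operation S n), 0 < n -> locally_term k f -> term_function f) ->
  finitely_related S.
Proof.
move=> e_full local_term.
pose row (s : k.-tuple 'I_(size e)) : k.-tuple S :=
  map_tuple (tnth (in_tuple e)) s.
have row_surj v : exists s, row s = v.
  have lt_e j : index (tnth v j) e < size e by rewrite index_mem.
  exists [tuple Ordinal (lt_e j) | j < k]; apply: eq_from_tnth => j.
  by rewrite tnth_map tnth_mktuple (tnth_nth (tnth v j)) /= nth_index.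
pose gens (B : {set k.-tuple 'I_(size e)}) v := exists2 s, s \in B & v = row s.
exists #|{set k.-tuple 'I_(size e)}|, (fun=> k),
  (fun l => generated (gens (enum_val l))) => n f n_gt0.
split=> [f_pres|/generated_preserved pres_f l]; last exact: pres_f.
apply: local_term => // P leP.
(* The first point pads the list of points to length k. *)
case: P leP => [|x0 P] leP; first by exists (Ordinal n_gt0), [::].
set Q := x0 :: P in leP *.
pose r : n.-tuple (k.-tuple S) :=
  [tuple [tuple tnth (nth x0 Q j) i | j < k] | i < n].
pose B := [set s | [exists i, row s == tnth r i]].
have := f_pres (enum_rank B) r; rewrite enum_rankK => gen_f.
have {}gen_f : generated (gens B)
    [tuple f [tuple tnth (tnth r i) j | i < n] | j < k].
  apply: gen_f => i; apply: generated_base; have [s rowE] := row_surj (tnth r i).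
  by exists s; rewrite // inE; apply/existsP; exists i; rewrite rowE.
have [|i [w wE]] := generated_word_eval (P := fun j => nth x0 Q j) _ gen_f.
  move=> u [s]; rewrite inE => /existsP[i /eqP rowE] ->; exists i => j.
  by rewrite rowE !tnth_mktuple.
exists i, w => x Qx.
have lt_k : index x Q < k by rewrite (leq_trans _ leP) ?index_mem.
have := wE (Ordinal lt_k); rewrite tnth_mktuple /= nth_index // => <-.
congr f; apply: eq_from_tnth => j.
by rewrite !tnth_mktuple /= nth_index.
Qed.
End Local.

(** * Words as duplicate-free lists of tokens *)

Lemma sorted_index (T : eqType) (s : seq T) :
  uniq s -> sorted (fun x y => index x s < index y s) s.
Proof.
case: s => // x0 s us; apply/(sortedP x0) => i lt_i.
by rewrite !index_uniq // ltnW.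
Qed.

Section Tokens.
Variable I : eqType.
Implicit Types (x y : I) (u v w : seq I) (p q : I * nat).

(** The token (x, k) stands for the occurrence of x that has k earlier
    occurrences; [seen] collects the letters read so far. Since tokens are
    pairwise distinct, the order of the tokens describes a word completely, and
    deleting letters is filtering tokens. *)
Fixpoint tokens_from seen w : seq (I * nat) :=
  if w is x :: w' then (x, count_mem x seen) :: tokens_from (x :: seen) w'
  else [::].

Definition tokens := tokens_from [::].

Lemma tokens_rcons w x : tokens (rcons w x) = rcons (tokens w) (x, count_mem x w).
Proof.
rewrite -[count_mem x w]/(0 + _) -[0]/(count_mem x [::]) /tokens.
elim: w [::] => [|y w IHw] seen /=; first by rewrite addn0.
by rewrite IHw /= addnCA addnA.
Qed.

Lemma tokensK w : unzip1 (tokens w) = w.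
Proof. by rewrite /tokens; elim: w [::] => //= x w IHw seen; rewrite IHw. Qed.

Lemma mem_tokens w x k : ((x, k) \in tokens w) = (k < count_mem x w).
Proof.
elim/last_ind: w => // w y IHw.
rewrite tokens_rcons mem_rcons inE IHw -cats1 count_cat /= addn0 xpair_eqE eq_sym.
case: eqP => [->|_]; last by rewrite addn0.
by rewrite addn1 ltnS [RHS]leq_eqVlt.
Qed.

Lemma tokens_uniq w : uniq (tokens w).
Proof.
elim/last_ind: w => // w x IHw.
by rewrite tokens_rcons rcons_uniq mem_tokens ltnn.
Qed.

Lemma count_mem_filter (P : pred I) w x : P x ->
  count_mem x (filter P w) = count_mem x w.
Proof.
move=> Px; rewrite count_filter; apply: eq_count => y /=.
by case: eqP => // ->.
Qed.

Lemma tokens_filter (P : pred I) w :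
  tokens (filter P w) = [seq p <- tokens w | P p.1].
Proof.
elim/last_ind: w => // w x IHw.
rewrite tokens_rcons !filter_rcons /=; case: ifP => // Px.
by rewrite tokens_rcons IHw count_mem_filter.
Qed.

(** The excluded pairs are two first or two second occurrences of repeated
    letters. *)
Definition visible_in w : rel (I * nat) := fun p q =>
  [|| count_mem p.1 w == 1, count_mem q.1 w == 1 | p.2 != q.2].

Definition token_index w p := index p (tokens w).
Definition precedes w : rel (I * nat) :=
  fun p q => token_index w p < token_index w q.

Lemma precedes_trans w : transitive (precedes w).
Proof. by move=> q p r; apply: ltn_trans. Qed.

Lemma precedes_irr w : irreflexive (precedes w).
Proof. by move=> p; apply: ltnn. Qed.

Lemma token_index_inj w p q :
  p \in tokens w -> token_index w p = token_index w q -> p = q.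
Proof.
move=> pw pq; apply: (index_inj p) (pq) => //.
by rewrite -index_mem -/(token_index w q) -pq index_mem.
Qed.

Lemma sorted_tokens_filter (P : pred I) w :
  sorted (precedes w) (tokens (filter P w)).
Proof.
rewrite tokens_filter; apply: sorted_filter; first exact: precedes_trans.
exact/sorted_index/tokens_uniq.
Qed.

(** A list that is sorted for a strict order is determined by its members. *)
Lemma tokens_eq u v w :
    (forall x, count_mem x u = count_mem x v) ->
    sorted (precedes w) (tokens u) -> sorted (precedes w) (tokens v) ->
  u = v.
Proof.
move=> cnt_uv sort_u sort_v; rewrite -[u]tokensK -[v]tokensK; congr unzip1.
apply: irr_sorted_eq (@precedes_trans w) (@precedes_irr w) _ _ sort_u sort_v _.
by case=> x k; rewrite !mem_tokens cnt_uv.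
Qed.

(** Turns the result of a deletion, which values of words detect, into
    multiplicities and inequalities between token positions. *)
Lemma filter_mem_eqP u w :
  reflect ({in w, forall x, count_mem x u = count_mem x w} /\
             sorted (precedes u) (tokens w))
          (filter (mem w) u == w).
Proof.
apply: (iffP eqP) => [wE | [cnt_w sort_w]].
  split=> [x xw|]; first by rewrite -[in RHS]wE count_mem_filter.
  by rewrite -wE sorted_tokens_filter.
apply: tokens_eq (sorted_tokens_filter _ u) sort_w => x.
have [xw|xw] := boolP (x \in w); first by rewrite count_mem_filter ?cnt_w.
by rewrite !(count_memPn _) // mem_filter /= (negPf xw).
Qed.

(** Adjacent tokens come from adjacent letters. *)
Lemma sorted_tokens (e : rel (I * nat)) w :
  (forall u x y v, w = u ++ x :: y :: v ->
     e (x, count_mem x u) (y, count_mem y (rcons u x))) ->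
  sorted e (tokens w).
Proof.
elim/last_ind: w => // w y IHw e_w.
have {}IHw : sorted e (tokens w).
  apply: IHw => u x z v wE; apply: (e_w _ _ _ (rcons v y)).
  by rewrite wE rcons_cat.
case/lastP: w e_w IHw => // w x e_w; rewrite !tokens_rcons => e_wx.
have e_xy := e_w w x y [::]; rewrite -!cats1 -catA in e_xy e_wx *.
have {}e_xy := e_xy erefl.
case: (tokens w) e_wx => [|p s] /=; first by rewrite andbT.
by rewrite !cat_path last_cat /= !andbT => /andP[-> ->].
Qed.

End Tokens.

(** A list of tokens obtained by sorting is the list of tokens of a word as soon
    as the ranks of each letter start at 0 and increase along the list. *)
Lemma tokens_unzip1 (I : eqType) (s : seq (I * nat)) : uniq s ->
    (forall x k, (x, k.+1) \in s -> index (x, k) s < index (x, k.+1) s) ->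
  tokens (unzip1 s) = s.
Proof.
elim/last_ind: s => // s [x k] IHs; rewrite rcons_uniq.
move=> /andP[xNs s_uniq] s_succ.
have succ_s y j : (y, j.+1) \in s -> index (y, j) s < index (y, j.+1) s.
  move=> yjs; have := s_succ y j; rewrite mem_rcons inE yjs orbT => /(_ isT).
  rewrite -cats1 !index_cat yjs; case: ifP => // _.
  rewrite ltnNge => /negP[]; apply: leq_trans (leq_addr _ _).
  by rewrite ltnW // index_mem.
have {IHs} sE := IHs s_uniq succ_s.
rewrite /unzip1 map_rcons tokens_rcons -/(unzip1 s) sE; congr (rcons s (x, _)).
apply/eqP; rewrite eqn_leq [_ <= k]leqNgt -mem_tokens sE xNs /=.
case: k s_succ xNs => [//|k] s_succ xNs; rewrite -mem_tokens sE.
have := s_succ x k; rewrite mem_rcons mem_head => /(_ isT).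
rewrite -cats1 !index_cat (negPf xNs) /= eqxx addn0.
by case: ifP => // _; rewrite ltnNge leq_addr.
Qed.

Lemma count_lt (X : eqType) (P Q : pred X) (s : seq X) x :
    {in s, subpred P Q} -> x \in s -> Q x -> ~~ P x ->
  count P s < count Q s.
Proof.
move=> PQ xs Qx nPx.
have sub u : {subset u <= s} -> count P u <= count Q u.
  elim: u => //= y u IHu us; apply: leq_add; last first.
    by apply: IHu => z zu; rewrite us // inE zu orbT.
  by case Py: (P y) => //; rewrite PQ // us ?mem_head.
case/splitPr: xs PQ sub => u v _ sub.
rewrite !count_cat /= Qx (negPf nPx) add0n addnCA add1n ltnS leq_add // sub //.
  by move=> y yu; rewrite mem_cat yu.
by move=> y yv; rewrite mem_cat inE yv !orbT.
Qed.

(** * Words sent to a factor of asabtb *)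

Lemma uniq4 (T : eqType) (a b c d : T) : uniq [:: a; b; c; d] ->
  [/\ [/\ a != b, a != c & a != d], b != c, b != d & c != d].
Proof.
rewrite /= !inE !negb_or !andbT.
by case/and3P=> /and3P[-> -> ->] /andP[-> ->] ->.
Qed.

Lemma count_flatten_map (I T : eqType) (psi : I -> seq T) c x v : c \in psi x ->
  count_mem x v <= count_mem c (flatten (map psi v)).
Proof.
move=> cx; elim: v => //= y v IHv; rewrite count_cat.
apply: leq_add => //; case: eqP => //= ->.
by rewrite -has_count has_pred1.
Qed.

Section Factors.
Variables (T : eqType) (a b s t : T).
Hypothesis abst : uniq [:: a; b; s; t].
Let W := [:: a; s; a; b; t; b].

Lemma letter_count_le2 c : count_mem c W <= 2.
Proof.
have [[/negPf ab /negPf as_ /negPf at_] /negPf bs /negPf bt /negPf st] :=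
  uniq4 abst.
rewrite /W /=; case: (eqVneq a c) => [<-|_].
  by rewrite ![_ == a]eq_sym ab as_ at_.
case: (eqVneq b c) => [<-|_]; first by rewrite ![_ == b]eq_sym bs bt.
case: (eqVneq s c) => [<-|_]; first by rewrite ![_ == s]eq_sym st.
by case: (t == c).
Qed.

Lemma letter_count_le1 c : c \in [:: s; t] -> count_mem c W <= 1.
Proof.
have [[/negPf ab /negPf as_ /negPf at_] /negPf bs /negPf bt /negPf st] :=
  uniq4 abst.
rewrite /W !inE => /orP[]/eqP-> /=; rewrite ?as_ ?bs ?at_ ?bt ?st ?eqxx //.
by rewrite eq_sym st.
Qed.

(** By inspection of all ways to place the two occurrences. *)
Lemma letter_twice A c B C : W = A ++ c :: B ++ c :: C ->
  [/\ A = [::], B = [:: s] & C = [:: b; t; b]] \/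
  [/\ A = [:: a; s; a], B = [:: t] & C = [::]].
Proof.
have [[/eqP ab /eqP as_ /eqP at_] /eqP bs /eqP bt /eqP st] := uniq4 abst.
rewrite /W; do 7?[case: A => [|? A] //=]; do 7?[case: B => [|? B] //=];
  by case=> *; subst; (by exfalso; congruence) || (by left) || right.
Qed.

Variables (I : eqType) (psi : I -> seq T).
Implicit Types (v : seq I).
Let F v := flatten (map psi v).

Lemma flatten_map_eq0 v : {in v, forall x, psi x != [::]} -> F v = [::] -> v = [::].
Proof.
case: v => // x v /(_ x (mem_head _ _)); rewrite /F /=.
by case: (psi x).
Qed.

Lemma flatten_map_eq1 v c : {in v, forall x, psi x != [::]} -> F v = [:: c] ->
  exists2 x, v = [:: x] & psi x = [:: c].
Proof.
case: v => // x v psi_v; rewrite /F /=; have := psi_v _ (mem_head _ _).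
case psix: (psi x) => [|d r] // _ [dc /nilP].
rewrite cat_nilp => /andP[/nilP r0 /nilP/flatten_map_eq0->] => [|y vy].
  by exists x; rewrite ?psix ?r0 ?dc.
by rewrite psi_v // inE vy orbT.
Qed.

Variable v : seq I.
Hypothesis psi_v : {in v, forall x, psi x != [::]}.
Hypothesis F_infix : infix (F v) W.

Let count_F x c : c \in psi x -> count_mem x v <= count_mem c W.
Proof.
move=> cx; have [A [B ->]] := infixP F_infix.
rewrite !count_cat; have := count_flatten_map v cx.
rewrite -/(F v); lia.
Qed.

Lemma factor_count_le2 x : count_mem x v <= 2.
Proof.
have [xv|/count_memPn-> //] := boolP (x \in v).
have := psi_v xv; case psix: (psi x) => [|c r] // _.
by apply: leq_trans (count_F _) (letter_count_le2 c); rewrite psix mem_head.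
Qed.

(** The image of x contains a letter c that occurs twice in W, and what is
    between these occurrences is s or t. If c were followed in the image of x
    by another letter, this would be that s or t, and it would follow the
    second c as well, which W excludes. So a single letter z is between the
    occurrences of x, its image is s or t, and z is not repeated. If c is a,
    then nothing precedes the first c in W; if c is b, then nothing follows the
    second. *)
Lemma factor_twice x : count_mem x v = 2 -> exists z q,
  [/\ z != x, count_mem z v = 1 & v = [:: x, z, x & q] \/ v = q ++ [:: x; z; x]].
Proof.
move=> cnt_x.
have xv : x \in v by rewrite -has_pred1 has_count cnt_x.
have [p1 [p2 [p3 vE]]] : exists p1 p2 p3, v = p1 ++ x :: p2 ++ x :: p3.
  case/splitPr: xv cnt_x => p1 q; rewrite count_cat /= eqxx => cnt_x.
  have [/splitPr[p2 p3]|xq] := boolP (x \in q); first by exists p1, p2, p3.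
  have /splitPr[p2 p3] : x \in p1.
    by rewrite -has_pred1 has_count; rewrite (count_memPn xq) in cnt_x; lia.
  by exists p2, p3, q; rewrite -catA.
have psi_x := psi_v xv; have [A [B]] := infixP F_infix.
rewrite {1}vE /F !(map_cat, flatten_cat) /= !(map_cat, flatten_cat) /= -/F.
case psix: (psi x) psi_x => [|c r] // _.
move=> WE; have /letter_twice : W =
    (A ++ F p1) ++ c :: (r ++ F p2) ++ c :: (r ++ F p3 ++ B).
  by rewrite WE; do 3!rewrite /= -?catA.
clear WE.
have psi_p (p : seq I) : {subset p <= v} -> {in p, forall y, psi y != [::]}.
  by move=> pv y /pv/psi_v.
have p1v : {subset p1 <= v} by move=> y yp; rewrite vE mem_cat yp.
have p2v : {subset p2 <= v}.
  by move=> y yp; rewrite vE !(mem_cat, inE) yp !orbT.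
have p3v : {subset p3 <= v}.
  by move=> y yp; rewrite vE !(mem_cat, inE) yp !orbT.
have cat0 (u w : seq T) : u ++ w = [::] -> u = [::] /\ w = [::].
  by case: u.
have middle d : d \in [:: s; t] -> F p2 = [:: d] ->
    exists z, [/\ z != x, count_mem z v = 1 & p2 = [:: z]].
  move=> d_st /(flatten_map_eq1 (psi_p _ p2v))[z p2z psiz]; exists z.
  have zv : z \in v by rewrite p2v // p2z mem_head.
  have cnt_z : count_mem z v = 1.
    apply/eqP; rewrite eqn_leq -has_count has_pred1 zv andbT.
    apply: leq_trans (letter_count_le1 d_st).
    by rewrite count_F // psiz mem_head.
  by split=> //; apply: contra_eqN cnt_z => /eqP->; rewrite cnt_x.
(* The branch c = a, and then the branch c = b. *)
case=> [] [A0 Bs].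
  case: r => [|d r] in psix Bs * => [_|]; last first.
    case: Bs => -> _ [sb]; move: abst; rewrite sb /= !inE eqxx ?orbT //=.
    by rewrite ?andbF.
  have [|z [zx cnt_z p2z]] := middle s _ Bs; first by rewrite inE eqxx.
  have [_ /(flatten_map_eq0 (psi_p _ p1v)) p10] := cat0 _ _ A0.
  by exists z, p3; split=> //; left; rewrite vE p10 p2z.
case/cat0=> r0 /cat0[/(flatten_map_eq0 (psi_p _ p3v)) p30 _].
rewrite r0 in Bs.
have [|z [zx cnt_z p2z]] := middle t _ Bs; first by rewrite !inE eqxx orbT.
by exists z, p1; split=> //; right; rewrite vE p30 p2z.
Qed.

(** By [factor_twice] each repeated letter x either starts v, as xzx, or ends
    it. In the first case nothing precedes the first x and the linear letter z
    immediately precedes the second; in the second case z immediately follows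
    the first x and nothing follows the second. Hence of two adjacent
    occurrences of different repeated letters, the left one is the second
    occurrence of the letter that starts v and the right one is the first
    occurrence of the letter that ends v. *)
Lemma visible_in_tokens : sorted (visible_in v) (tokens v).
Proof.
apply: sorted_tokens => u x y w vE; rewrite /visible_in /=.
have cnt c : c \in v -> count_mem c v != 1 -> count_mem c v = 2.
  rewrite -has_pred1 has_count; have := factor_count_le2 c; lia.
have xv : x \in v by rewrite vE !(mem_cat, inE) eqxx orbT.
have yv : y \in v by rewrite vE !(mem_cat, inE) eqxx !orbT.
apply/or3P; case: eqP => [_|/eqP/(cnt _ xv) cnt_x]; first by constructor 1.
case: eqP => [_|/eqP/(cnt _ yv) cnt_y]; first by constructor 2.
constructor 3; rewrite -cats1 count_cat /= addn0.
have [<-|xy] := eqVneq x y; first by rewrite addn1 neq_ltn leqnn.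
rewrite addn0; apply/eqP => cnt_xy.
have [z [q [zx cnt_z vx]]] := factor_twice cnt_x.
have [z' [q' [zy cnt_z' vy]]] := factor_twice cnt_y.
have zy' : z != y by apply: contra_eqN cnt_z => /eqP->; rewrite cnt_y.
have zx' : z' != x by apply: contra_eqN cnt_z' => /eqP->; rewrite cnt_x.
have [cx cy] : count_mem x u + (count_mem x w).+1 = 2 /\
               count_mem y u + (count_mem y w).+1 = 2.
  split; [rewrite -cnt_x | rewrite -cnt_y]; rewrite [in RHS]vE count_cat /= eqxx.
    by rewrite eq_sym (negPf xy).
  by rewrite (negPf xy).
have last_v : last y v = last y w by rewrite vE last_cat.
have last_in l (d : I) : count_mem (last d l) l = 0 -> l = [::].
  case: l => // d' l /= /eqP; rewrite addn_eq0 => /andP[].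
  have := mem_last d' l; rewrite inE => /predU1P[->|]; first by rewrite eqxx.
  by rewrite -has_pred1 has_count lt0n => /negPf->.
(* First the case in which the left letter x starts v. *)
case: vx => vx.
  case: u => [|x' u] in vE cnt_xy cx cy *.
    by move: vx; rewrite vE => -[yz]; rewrite yz eqxx in zy'.
  have x'x : x' = x by move: vx; rewrite vE => -[].
  have cyw : count_mem y w = 0 by move: cx cy cnt_xy; rewrite /= x'x eqxx; lia.
  case: vy => vy; first by move: vx; rewrite vy => -[yx]; rewrite yx eqxx in xy.
  have w0 : w = [::].
    by apply: (last_in _ y); rewrite -last_v vy last_cat.
  move: vE; rewrite vy w0 => /(congr1 rev); rewrite !rev_cat => -[].
  by move=> zx'x; rewrite zx'x eqxx in zx'.
have last_x : last y w = x by rewrite -last_v vx last_cat.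
case: vy => vy; last first.
  by move: last_v; rewrite last_x vy last_cat /= => yx; rewrite yx eqxx in xy.
case: u => [|y' u] in vE cnt_xy cx cy *.
  by move: vy; rewrite vE => -[yx]; rewrite yx eqxx in xy.
have y'y : y' = y by move: vy; rewrite vE => -[].
have w0 : w = [::].
  apply: (last_in _ y); rewrite last_x.
  by move: cx cy cnt_xy; rewrite /= y'y eqxx; lia.
by move: last_x xy; rewrite w0 /= => ->; rewrite eqxx.
Qed.
End Factors.

(** * Evaluation of words in a Rees quotient *)

Section Evaluation.
Variables (T : choiceType) (W : seq T) (n : nat).
Local Notation S := (factor_monoid W).
Local Notation proj := (factor_proj W).
Implicit Types (x : n.-tuple S) (u v w : seq 'I_n) (B : seq 'I_n).

(** The value 0 is represented by the empty word here; [value] treats it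
    separately. *)
Definition letters x (i : 'I_n) : seq T :=
  if tnth x i is Some u then val u else [::].

(** Evaluation extended to the empty word, which arises when letters are
    deleted. *)
Definition value w x : S :=
  if all (fun i => tnth x i != None) w then proj (flatten (map (letters x) w))
  else None.

Lemma proj_letters x i : tnth x i != None -> tnth x i = proj (letters x i).
Proof.
by rewrite /letters; case: (tnth x i) => // u _; rewrite factor_proj_val.
Qed.

Lemma proj0_neq : proj [::] <> None.
Proof. by rewrite /factor_proj insubT // infix0s. Qed.

Lemma word_eval_value i w x : word_eval i w x = value (i :: w) x.
Proof.
rewrite /value /word_eval; elim/last_ind: w => [|w j IHw] /=.
  by rewrite andbT cats0; case: eqP => [->|/eqP/proj_letters] //.
rewrite foldl_rcons {}IHw all_rcons map_rcons flatten_rcons /= andbCA.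
have [->|/proj_letters xj] := eqVneq (tnth x j) None => /=.
  by case: ifP => //; case: (proj _).
by case: ifP => // _; rewrite {1}xj catA; apply/esym/factor_projM.
Qed.

Lemma value_filter (P : pred 'I_n) w x :
  (forall i, i \in w -> ~~ P i -> tnth x i = proj [::]) ->
  value w x = value (filter P w) x.
Proof.
move=> x1; rewrite /value.
have [-> ->] //: all (fun i => tnth x i != None) w =
          all (fun i => tnth x i != None) (filter P w) /\
        flatten (map (letters x) w) = flatten (map (letters x) (filter P w)).
elim: w x1 => //= i w IHw x1.
have {IHw} [|] := IHw; first by move=> j jw; apply: x1; rewrite inE jw orbT.
case: (boolP (P i)) => /= [_ -> -> //|Pi -> ->].
rewrite /letters x1 ?mem_head //.
by rewrite /factor_proj insubT ?infix0s.
Qed.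

Definition zero_point B : n.-tuple S :=
  [tuple if i \in B then None else proj [::] | i < n].

Lemma value_zero_point w B :
  value w (zero_point B) = if has (mem B) w then None else proj [::].
Proof.
rewrite /value; case: ifPn => [/allP w0 | /allPn[i iw]].
  rewrite ifN; last first.
    apply/hasPn => i /w0; rewrite tnth_mktuple.
    by case: ifP => // iB _; apply/negP; rewrite /= iB.
  congr proj; elim: w w0 => //= i w IHw w0.
  rewrite IHw ?cats0 => [|j jw]; last by rewrite w0 // inE jw orbT.
  have := w0 i (mem_head _ _); rewrite /letters tnth_mktuple; case: ifP => // _ _.
  by rewrite /factor_proj insubT ?infix0s.
rewrite negbK tnth_mktuple => /eqP w0.
rewrite ifT //; apply/hasP; exists i => //=.
by case: (i \in B) w0 => // /proj0_neq.
Qed.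

(** Each letter with a value other than 1 contributes to the length of a factor
    of W. *)
Lemma value_size w x v : value w x != None -> uniq v -> {subset v <= w} ->
  {in v, forall i, tnth x i != proj [::]} -> size v <= size W.
Proof.
rewrite /value; case: ifP => // /allP w0 neq0 v_uniq vw x_v.
have /size_infix : infix (flatten (map (letters x) w)) W.
  by apply: contraR neq0 => Ninf; rewrite /factor_proj insubN.
apply: leq_trans.
have: size v <= size [seq i <- w | letters x i != [::]].
  apply: uniq_leq_size => // i iv; rewrite mem_filter vw // andbT.
  apply: contra (x_v i iv) => /eqP xi0.
  by rewrite proj_letters ?xi0 // w0 ?vw.
move/leq_trans; apply; elim: (w) => //= i u IHu; rewrite size_cat.
by case: (letters x i) => //= c r; rewrite addSn ltnS (leq_trans IHu) ?leq_addl.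
Qed.

Variable a : T.
Hypothesis aW : a \in W.

(** If w has the same pattern of repetitions as an initial factor of W, then
    [code w] is the renaming of letters that turns w into this factor. *)
Definition code w i := nth a W (index i w).

Definition letter_point w : n.-tuple S :=
  [tuple if i \in w then proj [:: code w i] else proj [::] | i < n].

Lemma letters_letter_point w i :
  letters (letter_point w) i = if i \in w then [:: code w i] else [::].
Proof.
rewrite /letters tnth_mktuple; case: ifP => _; last first.
  by rewrite /factor_proj insubT ?infix0s.
have cW : code w i \in W.
  rewrite /code; have [lt_i|] := ltnP (index i w) (size W); first exact: mem_nth.
  by move=> le_i; rewrite nth_default.
rewrite /factor_proj insubT //; case/splitPr: cW => A B.
by apply/infixP; exists A, B.
Qed.

(** The point [letter_point w] deletes the letters outside w and renames the
    others injectively, so that the value recognizes whether w is what remains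
    of v. *)
Lemma value_letter_point w v :
    {in w &, injective (code w)} -> infix (map (code w) w) W ->
  (value v (letter_point w) == proj (map (code w) w)) =
    (filter (mem w) v == w).
Proof.
move=> code_inj code_w; rewrite /value ifT; last first.
  apply/allP => i iv; rewrite tnth_mktuple; have := letters_letter_point w i.
  rewrite /letters tnth_mktuple; case: ifP => // _; first by case: (proj _).
  by move=> _; apply/eqP/proj0_neq.
have ->: flatten (map (letters (letter_point w)) v) =
         map (code w) (filter (mem w) v).
  elim: v => //= i v ->; rewrite letters_letter_point.
  by case: (i \in w).
apply/eqP/eqP => [/factor_proj_eq[|[_]]|->] //; last by rewrite code_w.
apply: (inj_in_map code_inj); rewrite inE; apply/allP => i //.
by rewrite mem_filter => /andP[].
Qed.
End Evaluation.

(** * Gluing the local words *)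

(** The predicates [content] and [reads] stand for what is known of an operation
    f: the letters on which f depends, and the words w such that a term agreeing
    with f becomes w when the letters outside w are deleted. *)
Section Order.
Variables (I : finType) (content : pred I) (reads : pred (seq I)).
Implicit Types (x y z : I) (p q r : I * nat) (t u w D : seq I).

Definition linear z := reads [:: z].
Definition linear_before x z := (x != z) && reads [:: x; z].
Definition between x z := (x != z) && reads [:: x; z; x].
Definition separated x := [exists z, between x z].
Definition separator x := odflt x [pick z | between x z].
(** The second occurrence of x is before the first occurrence of y. A common
    separator of x and y would be after the first y and before the second x, so
    that the answer is negative in this case. *)
Definition second_before_first x y := uniq [:: x; separator x; y; separator y] &&
  reads [:: x; separator x; x; y; separator y; y].

(** On the letters of D, the word t has the content and the deletions that f
    prescribes. *)
Definition conforms t D :=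
  [/\ {in D, forall x, content x = (x \in t)},
      {in D, forall x, reads [:: x] = (filter (mem [:: x]) t == [:: x])},
      {in D &, forall x z, x != z ->
         reads [:: x; z] = (filter (mem [:: x; z]) t == [:: x; z])},
      {in D &, forall x z, x != z ->
         reads [:: x; z; x] = (filter (mem [:: x; z; x]) t == [:: x; z; x])} &
      {in D &, forall x z, {in D &, forall y z', uniq [:: x; z; y; z'] ->
         reads [:: x; z; x; y; z'; y] =
           (filter (mem [:: x; z; x; y; z'; y]) t == [:: x; z; x; y; z'; y])}}].

Lemma conforms_linear t D x :
  conforms t D -> x \in D -> linear x = (count_mem x t == 1).
Proof.
case=> _ + _ _ _ => /[swap] xD /(_ x xD); rewrite /linear => ->.
apply/filter_mem_eqP/eqP => [[/(_ x)]|cnt_x].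
  by rewrite inE eqxx /= eqxx => /(_ isT).
by split=> // y; rewrite inE => /eqP->; rewrite /= eqxx cnt_x.
Qed.

Lemma conforms_before t D x z : conforms t D ->
    x \in D -> z \in D -> linear x -> linear z ->
  linear_before x z = (token_index t (x, 0) < token_index t (z, 0)).
Proof.
move=> t_D xD zD; rewrite !(conforms_linear t_D) // => /eqP cnt_x /eqP cnt_z.
rewrite /linear_before; have [->|xz] := eqVneq x z; first by rewrite ltnn.
case: t_D => _ _ + _ _ => /(_ x z xD zD xz) => -> /=.
have tok : tokens [:: x; z] = [:: (x, 0); (z, 0)].
  by rewrite /tokens /= (negPf xz).
apply/filter_mem_eqP/idP => [[_]|xz_t]; first by rewrite tok /= andbT.
split; last by rewrite tok /= andbT.
move=> y; rewrite !inE => /orP[]/eqP-> /=.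
  by rewrite eqxx [z == x]eq_sym (negPf xz) cnt_x.
by rewrite eqxx (negPf xz) cnt_z.
Qed.

Lemma conforms_between t D x z : conforms t D -> x \in D -> z \in D ->
  between x z = [&& count_mem x t == 2, count_mem z t == 1,
     token_index t (x, 0) < token_index t (z, 0) &
     token_index t (z, 0) < token_index t (x, 1)].
Proof.
move=> t_D xD zD; rewrite /between; have [->|xz] := eqVneq x z.
  by apply/esym/negP => /and3P[/eqP-> ].
case: t_D => _ _ _ + _ => /(_ x z xD zD xz) => -> /=.
have tok : tokens [:: x; z; x] = [:: (x, 0); (z, 0); (x, 1)].
  by rewrite /tokens /= eqxx (negPf xz) eq_sym (negPf xz).
apply/filter_mem_eqP/and4P => [[cnt]|[/eqP cnt_x /eqP cnt_z lt1 lt2]].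
  rewrite tok /= andbT => /andP[lt1 lt2]; split=> //.
    by rewrite cnt ?mem_head //= eqxx [z == x]eq_sym (negPf xz).
  by rewrite cnt ?inE ?eqxx ?orbT //= eqxx (negPf xz).
split; last by rewrite tok /= andbT; apply/andP.
move=> y; rewrite !inE orbCA orbb orbC => /orP[]/eqP-> /=.
  by rewrite eqxx [z == x]eq_sym (negPf xz) cnt_x.
by rewrite eqxx (negPf xz) cnt_z.
Qed.

Lemma between_separator x : separated x -> between x (separator x).
Proof.
case/existsP=> z xz; rewrite /separator; case: pickP => [//|/(_ z)].
by rewrite xz.
Qed.

Lemma conforms_separated t D x : conforms t D ->
    x \in D -> separator x \in D -> separated x ->
  [/\ x != separator x, count_mem x t = 2, count_mem (separator x) t = 1,
     token_index t (x, 0) < token_index t (separator x, 0) &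
     token_index t (separator x, 0) < token_index t (x, 1)].
Proof.
move=> t_D xD wD /between_separator x_w.
have := x_w; rewrite (conforms_between t_D) // => /and4P[/eqP-> /eqP-> -> ->].
by move: x_w; case/andP=> ->.
Qed.

Lemma conforms_second_before_first t D x y : conforms t D ->
    x \in D -> y \in D -> separator x \in D -> separator y \in D ->
    separated x -> separated y -> x != y ->
  second_before_first x y = (token_index t (x, 1) < token_index t (y, 0)).
Proof.
move=> t_D xD yD wxD wyD.
move=> /(conforms_separated t_D xD wxD) + /(conforms_separated t_D yD wyD).
set x' := separator x; set y' := separator y.
move=> [xx' cnt_x cnt_x' lt_x lt_x'] [yy' cnt_y cnt_y' lt_y lt_y'] xy.
have neq (u v : I) : count_mem u t = 2 -> count_mem v t = 1 -> u != v.
  by move=> cu cv; apply: contra_eqN cv => /eqP<-; rewrite cu.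
rewrite /second_before_first -/x' -/y'.
have [x'y'|x'y'] := eqVneq x' y'.
  rewrite /= x'y' !inE eqxx ?orbT !andbF /=; apply/esym/negbTE.
  by rewrite -leqNgt; move: lt_x' lt_y; rewrite x'y'; lia.
have /and4P[/negPf nxx' /negPf nxy /negPf nxy' /negPf nx'y] :
   [&& x != x', x != y, x != y' & x' != y].
  by rewrite xx' xy neq //= eq_sym neq.
have nx'y' := negPf x'y'; have nyy' := negPf yy'.
have nE := (nxx', nxy, nxy', nx'y, nx'y', nyy').
have {}nE := (nE, (eq_sym x' x, eq_sym y x, eq_sym y' x,
                   eq_sym y x', eq_sym y' x', eq_sym y' y)).
have u4 : uniq [:: x; x'; y; y'] by rewrite /= !inE !nE.
case: t_D => _ _ _ _ /(_ x x' xD wxD y y' yD wyD u4) => ->; rewrite u4 /=.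
have tok : tokens [:: x; x'; x; y; y'; y] =
    [:: (x, 0); (x', 0); (x, 1); (y, 0); (y', 0); (y, 1)].
  by rewrite /tokens /= !(eqxx, nE).
apply/filter_mem_eqP/idP => [[_]|xy_t].
  by rewrite tok /= => /and4P[].
split; last by rewrite tok /= andbT; apply/and5P.
by move=> z; rewrite !inE => /or4P[||| /or3P[]] /eqP->;
   rewrite /= !(eqxx, nE) ?cnt_x ?cnt_y ?cnt_x' ?cnt_y'.
Qed.

Definition regular_token p :=
  linear p.1 && (p.2 == 0) || separated p.1 && (p.2 < 2).
(** The analogue of [visible_in], with multiplicities read off from f. *)
Definition visible p q := [|| linear p.1, linear q.1 | p.2 != q.2].

(** The order of the tokens p and q in a word that agrees with f, for visible
    pairs. Between a linear and a separated letter it is determined by their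
    position relative to the separator: for instance y is after the first x when
    it is between the two x or after the separator of x. *)
Definition ahead p q :=
  let: (x, i) := p in let: (y, j) := q in
  if linear x then
    if linear y then linear_before x y
    else if j == 0 then ~~ (between y x || linear_before (separator y) x)
    else between y x || linear_before x (separator y)
  else if linear y then
    if i == 0 then between x y || linear_before (separator x) y
    else ~~ (between x y || linear_before y (separator x))
  else if x == y then i < j
  else if i == 0 then (j != 0) && ~~ second_before_first y x
  else (j == 0) && second_before_first x y.

Definition supported D p := (p.1 \in D) && (separator p.1 \in D).

Lemma conforms_regular_token t D x : conforms t D ->
    x \in D -> separator x \in D ->
  linear x || separated x -> forall k, regular_token (x, k) = (k < count_mem x t).
Proof.
move=> t_D xD wD x_ok k; rewrite /regular_token /=.
have [sx|nsx] := boolP (separated x).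
  have [_ -> _ _ _] := conforms_separated t_D xD wD sx.
  have [lx|] := boolP (linear x); last by rewrite orFb.
  by case: k => [|[|k]]; rewrite ?andbF ?orbT.
move: x_ok; rewrite (negPf nsx) orbF => lx; rewrite lx orbF /=.
by move: lx; rewrite (conforms_linear t_D) // => /eqP->; case: k.
Qed.

Lemma conforms_linear_separated t D x z : conforms t D ->
    x \in D -> separator x \in D -> z \in D -> separated x -> linear z ->
  [/\ between x z || linear_before (separator x) z =
        (token_index t (x, 0) < token_index t (z, 0)),
      between x z || linear_before z (separator x) =
        (token_index t (z, 0) < token_index t (x, 1)),
      token_index t (x, 0) != token_index t (z, 0) &
      token_index t (x, 1) != token_index t (z, 0)].
Proof.
move=> t_D xD wD zD sx lz.
have [_ cx cw lt1 lt2] := conforms_separated t_D xD wD sx.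
have cz : count_mem z t = 1 by apply/eqP; rewrite -(conforms_linear t_D).
have lw : linear (separator x) by rewrite (conforms_linear t_D) ?cw.
have neq i : i < 2 -> token_index t (x, i) != token_index t (z, 0).
  move=> i2; apply/eqP => /token_index_inj; rewrite mem_tokens cx => /(_ i2)[xz _].
  by move: cx; rewrite xz cz.
rewrite (conforms_between t_D) // cx cz /= !(conforms_before t_D) //.
split; rewrite ?neq //; lia.
Qed.

Lemma conforms_ahead t D p q : conforms t D -> supported D p -> supported D q ->
    regular_token p -> regular_token q -> visible p q ->
  ahead p q = (token_index t p < token_index t q).
Proof.
case: p q => [x i] [y j] t_D /andP[/= xD wxD] /andP[/= yD wyD].
rewrite /regular_token /visible /=.
have [lx|nlx] := boolP (linear x); have [ly|nly] := boolP (linear y) => /=.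
- have nspread z : z \in D -> separator z \in D -> linear z -> separated z = false.
    move=> zD wD; rewrite (conforms_linear t_D) // => cz; apply/negbTE/negP.
    by move=> /(conforms_separated t_D zD wD)[_ cz2 _ _ _]; rewrite cz2 in cz.
  rewrite !nspread // !orbF => /eqP-> /eqP-> _.
  exact: (conforms_before t_D).
- have [->|_] := eqVneq i 0; last first.
    move=> /= /andP[/(conforms_separated t_D xD wxD)[_ cx _ _ _] _].
    by move: lx; rewrite (conforms_linear t_D) // cx.
  move=> _ /andP[sy j2] _.
  have [AA BB neq0 _] := conforms_linear_separated t_D yD wyD xD sy lx.
  case: j j2 => [|[|//]] _ /=; rewrite ?AA ?BB //.
  by rewrite -leqNgt ltn_neqAle eq_sym neq0.
- move=> /andP[sx i2] + _; have [->|_] := eqVneq j 0; last first.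
    move=> /= /andP[/(conforms_separated t_D yD wyD)[_ cy _ _ _] _].
    by move: ly; rewrite (conforms_linear t_D) // cy.
  move=> _.
  have [AA BB _ neq1] := conforms_linear_separated t_D xD wxD yD sx ly.
  by case: i i2 => [|[|//]] _ /=; rewrite ?AA ?BB // -leqNgt ltn_neqAle neq1.
move=> /andP[sx i2] /andP[sy j2] ij.
have [_ cx _ ltx1 ltx2] := conforms_separated t_D xD wxD sx.
have [_ cy _ lty1 lty2] := conforms_separated t_D yD wyD sy.
have [<-|xy] := eqVneq x y.
  case: i j i2 j2 ij => [|[|//]] [|[|//]] //= _ _ _.
    by rewrite (ltn_trans ltx1).
  by apply/esym/negbTE; rewrite -leqNgt ltnW // (ltn_trans ltx1).
case: i j i2 j2 ij => [|[|//]] [|[|//]] //= _ _ _; last first.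
  exact: (conforms_second_before_first t_D).
rewrite (conforms_second_before_first t_D) //; last by rewrite eq_sym.
rewrite -leqNgt leq_eqVlt orbC; case: ltnP => //= _.
apply/negP => /eqP/token_index_inj; rewrite mem_tokens cx => /(_ isT)[xy' _].
by rewrite xy' eqxx in xy.
Qed.

Lemma ahead_visible p q :
  regular_token p -> regular_token q -> ahead p q -> visible p q.
Proof.
case: p q => [x i] [y j]; rewrite /regular_token /visible /=.
case: (linear x) => //=; case: (linear y) => //= /andP[_ i2] /andP[_ j2].
case: eqP => [_|_]; first by rewrite neq_ltn => ->.
by case: i i2 => [|[|//]] _; case: j j2 => [|[|//]].
Qed.

Definition regular_tokens : seq (I * nat) :=
  [seq (x, 0) | x <- enum I & linear x || separated x] ++
  [seq (x, 1) | x <- enum I & separated x].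

Lemma mem_regular_tokens p : (p \in regular_tokens) = regular_token p.
Proof.
case: p => x k; rewrite mem_cat /regular_token /=; apply/orP/idP.
  by case=> /mapP[y]; rewrite mem_filter mem_enum andbT => y_ok [-> ->] /=;
    rewrite ?andbT ?y_ok ?andbF ?orbT.
case: k => [|[|k]]; rewrite ?andbT ?andbF //= => x_ok; [left|right];
  by apply/mapP; exists x; rewrite // mem_filter mem_enum andbT.
Qed.

Lemma regular_tokens_uniq : uniq regular_tokens.
Proof.
have pair_inj (k : nat) : injective (fun x : I => (x, k)) by move=> x y [].
rewrite cat_uniq !(map_inj_uniq (pair_inj _)) !(filter_uniq _ (enum_uniq _)).
rewrite andbT /=.
by apply/hasPn => _ /mapP[x _ ->]; apply/mapP => -[].
Qed.

(** At most two steps are enough for transitivity, see [ahead_path]. *)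
Definition ahead_within2 p q :=
  ahead p q || has (fun r => ahead p r && ahead r q) regular_tokens.

(** Twelve letters are six letters together with their separators. *)
Hypothesis local_conforms : forall D, size D <= 12 -> exists t, conforms t D.

Definition support (s : seq (I * nat)) : seq I :=
  unzip1 s ++ map separator (unzip1 s).

Lemma support_closed s p : p \in s -> supported (support s) p.
Proof.
move=> ps; rewrite /supported !mem_cat.
have ps1 : p.1 \in unzip1 s by apply/mapP; exists p.
by rewrite ps1 (map_f separator ps1) orbT.
Qed.

Lemma local_ahead s : size s <= 6 -> exists2 t,
  conforms t (support s) &
  {in s &, forall p q, regular_token p -> regular_token q -> visible p q ->
     ahead p q = (token_index t p < token_index t q)}.
Proof.
move=> s6; have [|t t_s] := local_conforms (D := support s).
  by rewrite size_cat !size_map; lia.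
exists t => // p q ps qs.
by apply: (conforms_ahead t_s); apply: support_closed.
Qed.

(** In a local word the path is increasing. If its ends are visible to each
    other, then [ahead] relates them directly. Otherwise they have equal ranks
    and their letters are separated, so that the second token of the path,
    being visible from the first, is visible from the last too. *)
Lemma ahead_path p s : size s <= 4 -> s != [::] -> all regular_token (p :: s) ->
  path ahead p s -> ahead_within2 p (last p s).
Proof.
move=> s4 s0 s_valid s_path.
have [|t _ t_s] := local_ahead (s := p :: s).
  by rewrite /= ltnS (leq_trans s4).
have valid_s q : q \in p :: s -> regular_token q by move/allP: s_valid => /(_ q).
have ahead_s : {in p :: s &, forall q r,
    ahead q r -> token_index t q < token_index t r}.
  move=> q r qs rs qr; rewrite -t_s ?valid_s //.
  by apply: ahead_visible qr; apply: valid_s.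
have s_sorted : path (precedes t) p s.
  exact: (sub_in_path ahead_s (allss (p :: s))) s_path.
have lt_s := order_path_min (@precedes_trans _ t) s_sorted.
case: s => // r s in s4 s0 s_valid valid_s ahead_s t_s s_path s_sorted lt_s *.
set q := last p (r :: s).
have qs : q \in p :: r :: s := mem_last p (r :: s).
have rs : r \in p :: r :: s by rewrite !inE eqxx orbT.
have ps := mem_head p (r :: s).
have [pq|npq] := boolP (visible p q).
  rewrite /ahead_within2 t_s ?valid_s // /q.
  by have /allP/(_ _ (mem_last _ _)) := lt_s; rewrite /precedes => ->.
have pr : ahead p r by case/andP: s_path.
have p_r : visible p r by apply: ahead_visible pr; apply: valid_s.
apply/orP; right; apply/hasP; exists r; first by rewrite mem_regular_tokens valid_s.
rewrite pr /=.
have rq : visible r q.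
  move: npq p_r; rewrite /visible !negb_or negbK.
  move=> /and3P[/negPf-> /negPf-> /eqP->].
  by rewrite /= [r.2 == _]eq_sym.
rewrite t_s ?valid_s //.
have /predU1P[qr|qin] : q \in r :: s := mem_last r s.
  by rewrite qr p_r in npq.
case/andP: s_sorted => _ /(order_path_min (@precedes_trans _ t))/allP; exact.
Qed.

Lemma ahead_within2_trans p q r :
    regular_token p -> regular_token q -> regular_token r ->
  ahead_within2 p q -> ahead_within2 q r -> ahead_within2 p r.
Proof.
move=> pV qV rV.
have hasE q1 q2 : has (fun m => ahead q1 m && ahead m q2) regular_tokens ->
    exists2 m, regular_token m & ahead q1 m /\ ahead m q2.
  by case/hasP=> m; rewrite mem_regular_tokens => mV /andP[]; exists m.
case/orP=> [pq|/hasE[m mV [pm mq]]]; case/orP=> [qr|/hasE[m' mV' [qm mr]]].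
- by apply: (ahead_path (s := [:: q; r])); rewrite //= ?pV ?qV ?rV ?pq ?qr.
- by apply: (ahead_path (s := [:: q; m'; r]));
    rewrite //= ?pV ?qV ?rV ?mV' ?pq ?qm ?mr.
- by apply: (ahead_path (s := [:: m; q; r]));
    rewrite //= ?pV ?qV ?rV ?mV ?pm ?mq ?qr.
by apply: (ahead_path (s := [:: m; q; m'; r]));
  rewrite //= ?pV ?qV ?rV ?mV ?mV' ?pm ?mq ?qm ?mr.
Qed.

Lemma ahead_within2_irr p : regular_token p -> ~~ ahead_within2 p p.
Proof.
move=> pV; apply/negP; case/orP=> [pp|/hasP[r]].
  have [|t _ t_s] := local_ahead (s := [:: p]) => //.
  have := ahead_visible pV pV pp.
  by move=> /(t_s _ _ (mem_head _ _) (mem_head _ _) pV pV); rewrite pp ltnn.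
rewrite mem_regular_tokens => rV /andP[pr rp].
have [|t _ t_s] := local_ahead (s := [:: p; r]) => //.
have := t_s p r; rewrite !inE !eqxx orbT.
move=> /(_ isT isT pV rV (ahead_visible pV rV pr)).
have := t_s r p; rewrite !inE !eqxx orbT.
move=> /(_ isT isT rV pV (ahead_visible rV pV rp)).
by rewrite pr rp => /esym lt1 /esym; rewrite ltnNge ltnW.
Qed.

Lemma separated_not_linear x : separated x -> ~~ linear x.
Proof.
move=> sx; have [//|t t_x] := local_conforms (D := [:: x; separator x]).
have [||_ cx _ _ _] := conforms_separated t_x _ _ sx; rewrite ?inE ?eqxx ?orbT //.
by rewrite (conforms_linear t_x) ?mem_head ?cx.
Qed.

(** The size of the down-set: sorting by it is a linear extension. *)
Definition score p := count (ahead_within2^~ p) regular_tokens.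

Lemma score_ahead p q :
  regular_token p -> regular_token q -> ahead p q -> score p < score q.
Proof.
move=> pV qV pq; have pq2 : ahead_within2 p q by rewrite /ahead_within2 pq.
apply: (count_lt (x := p)) => //; first last.
- exact: ahead_within2_irr.
- by rewrite mem_regular_tokens.
move=> r; rewrite mem_regular_tokens => rV rp.
exact: ahead_within2_trans rp pq2.
Qed.

Definition ordering := sort (fun p q => score p <= score q) regular_tokens.
Definition glued_word := unzip1 ordering.

Lemma tokens_glued_word : tokens glued_word = ordering /\
  forall p q, regular_token p -> regular_token q -> ahead p q ->
    token_index glued_word p < token_index glued_word q.
Proof.
have ord_lt p q : regular_token p -> regular_token q -> ahead p q ->
    index p ordering < index q ordering.
  move=> pV qV /(score_ahead pV qV); apply: contraTT; rewrite -!leqNgt.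
  apply: (@sorted_leq_index _ (fun p q => score p <= score q)).
  - by move=> ? ? ?; apply: leq_trans.
  - by move=> ?; apply: leqnn.
  - by apply: sort_sorted => ? ?; apply: leq_total.
  - by rewrite mem_sort mem_regular_tokens.
  - by rewrite mem_sort mem_regular_tokens.
have ordE : tokens glued_word = ordering; last first.
  by split=> //; rewrite /token_index ordE.
apply: tokens_unzip1 => [|x k]; first by rewrite sort_uniq regular_tokens_uniq.
rewrite mem_sort mem_regular_tokens => xkV; have := xkV.
rewrite /regular_token /= andbF orFb => /andP[sx k1].
apply: ord_lt => //; first by rewrite /regular_token sx ltnW ?orbT.
by rewrite /ahead /= (negPf (separated_not_linear sx)) eqxx.
Qed.

Lemma count_glued_word x k : (k < count_mem x glued_word) = regular_token (x, k).
Proof.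
by rewrite -mem_tokens (proj1 tokens_glued_word) mem_sort mem_regular_tokens.
Qed.

(** Both words have the same tokens over N, and visible pairs are in the same
    order in both. If consecutive tokens of one of them are visible pairs, then
    this word is also sorted for the order of the other one. *)
Lemma conforms_glued t D (N : seq I) : conforms t D ->
    {in N, forall x,
      [&& x \in D, separator x \in D & linear x || separated x]} ->
  let v := filter (mem N) t in let u := filter (mem N) glued_word in
  sorted (visible_in v) (tokens v) || sorted (visible_in u) (tokens u) -> v = u.
Proof.
move=> t_D N_ok v u.
have cnt_t x : x \in N -> count_mem x t = count_mem x glued_word.
  move=> /N_ok/and3P[xD wD x_ok].
  have E k : (k < count_mem x t) = (k < count_mem x glued_word).
    by rewrite count_glued_word (conforms_regular_token t_D).
  by apply/eqP; rewrite eqn_leq leqNgt E ltnn leqNgt -E ltnn.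
have cnt x : count_mem x v = count_mem x u.
  have [xN|xN] := boolP (x \in N); first by rewrite !count_mem_filter // cnt_t.
  by rewrite !(count_memPn _) // mem_filter /= (negPf xN).
have tokN p : p \in tokens u ->
    [/\ supported D p, regular_token p, p \in tokens t &
     linear p.1 = (count_mem p.1 u == 1)].
  case: p => x k; rewrite !mem_tokens => k_u.
  have : x \in u by rewrite -has_pred1 has_count (leq_ltn_trans _ k_u).
  rewrite mem_filter => /andP[/= xN _]; have /and3P[xD wD x_ok] := N_ok x xN.
  move: k_u; rewrite !count_mem_filter // cnt_t // => k_u.
  by rewrite /supported xD wD -count_glued_word (conforms_linear t_D) // cnt_t.
have tok_uv : tokens v =i tokens u by case=> x k; rewrite !mem_tokens cnt.
have crossE p q : visible_in v p q = visible_in u p q by rewrite /visible_in !cnt.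
have t_u p q : p \in tokens u -> q \in tokens u -> visible_in u p q ->
    precedes t p q = precedes glued_word p q.
  move=> /tokN[pD pV pt p1] /tokN[qD qV qt q1]; rewrite /visible_in -p1 -q1 => pq.
  have qp : visible q p by rewrite /visible orbCA eq_sym.
  rewrite /precedes -(conforms_ahead t_D) //; apply/idP/idP.
    exact: (proj2 tokens_glued_word).
  rewrite (conforms_ahead t_D) //; apply: contraTT; rewrite -!leqNgt leq_eqVlt.
  case/predU1P=> [/esym/(token_index_inj pt)->//|].
  rewrite -(conforms_ahead t_D) //.
  by move/(proj2 tokens_glued_word _ _ qV pV)/ltnW.
have sort_v := sorted_tokens_filter (mem N) t.
have sort_u := sorted_tokens_filter (mem N) glued_word.
case/orP => vis.
- apply: (tokens_eq cnt _ sort_u).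
  have : sorted (fun p q => precedes t p q && visible_in u p q) (tokens v).
    rewrite sorted_relI sort_v /=; apply: sub_sorted vis => p q.
    by rewrite crossE.
  apply: sub_in_sorted (allss _) => p q; rewrite !tok_uv => pu qu /andP[+ pq].
  by rewrite t_u.
apply: (tokens_eq cnt sort_v).
have : sorted (fun p q => precedes glued_word p q && visible_in u p q) (tokens u).
  by rewrite sorted_relI sort_u.
by apply: sub_in_sorted (allss _) => p q pu qu /andP[+ pq]; rewrite t_u.
Qed.
End Order.

(** * Operations that are locally terms *)

Fixpoint words (X : Type) (D : seq X) j : seq (seq X) :=
  if j is j'.+1 then [::] :: [seq x :: w | x <- D, w <- words D j'] else [:: [::]].

Fixpoint words_bound d j := if j is j'.+1 then (d * words_bound d j').+1 else 1.

Lemma mem_words (X : eqType) (D w : seq X) j :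
  {subset w <= D} -> size w <= j -> w \in words D j.
Proof.
elim: j w => [|j IHj] [|x w] //= wD w_j; rewrite inE /=.
apply/allpairsP; exists (x, w); split=> //=.
  by rewrite wD ?mem_head.
by apply: IHj => // y yw; rewrite wD // inE yw orbT.
Qed.

Lemma size_words (X : Type) (D : seq X) d j :
  size D <= d -> size (words D j) <= words_bound d j.
Proof.
by move=> Dd; elim: j => //= j IHj; rewrite size_allpairs ltnS leq_mul.
Qed.

Lemma uniq_map_inj (X Y : eqType) (f : X -> Y) (s : seq X) :
  uniq (map f s) -> {in s &, injective f}.
Proof.
elim: s => // x s IHs /= /andP[xs us] y z; rewrite !inE.
case/predU1P=> [->|ys]; case/predU1P=> [->|zs] // fyz; last exact: IHs.
  by rewrite fyz map_f in xs.
by rewrite -fyz map_f in xs.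
Qed.

Section Main.
Variables (T : choiceType) (a b s t : T).
Hypothesis abst : uniq [:: a; b; s; t].
Let W := [:: a; s; a; b; t; b].
Local Notation S := (factor_monoid W).
Local Notation proj := (factor_proj W).

(** Counts the points used in [local_word]: those that read a word of length at
    most 6 over 12 letters, one zero point for each of these letters, the point
    of interest, and the point that is 0 exactly outside the content. *)
Definition locality := words_bound 12 6 + 12 + 2.

Variables (n : nat) (f : operation S n).
Hypothesis f_local : locally_term locality f.
Implicit Types (x : n.-tuple S) (i j : 'I_n) (u v w D : seq 'I_n).

Definition content : pred 'I_n := fun i => f (zero_point W [:: i]) == None.
Definition reads : pred (seq 'I_n) := fun w =>
  f (letter_point W a w) == proj (map (code W a w) w).

Let aW : a \in W. Proof. exact: mem_head. Qed.

Lemma local_value (P : seq (n.-tuple S)) : size P <= locality ->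
  exists2 w, w != [::] & {in P, forall x, f x = value w x}.
Proof.
case/f_local=> i [w wE]; exists (i :: w) => // x xP.
by rewrite wE // word_eval_value.
Qed.

(** A term agreeing with f at three points shows that one more letter outside
    the content can be sent to 0; no single list of bounded length contains the
    points for all these letters. *)
Lemma zero_point_noncontent (B : seq 'I_n) : all (predC content) B ->
  f (zero_point W B) = proj [::].
Proof.
elim: B => [_|i B IHB /= /andP[iNc /IHB fB]].
  have [|w _ /(_ _ (mem_head _ _))->] := @local_value [:: zero_point W [::]].
    by rewrite /locality addn2.
  by rewrite value_zero_point has_pred0.
have [|w _ wE] :=
  @local_value [:: zero_point W [:: i]; zero_point W B; zero_point W (i :: B)].
  by rewrite /locality -addnA; apply: leq_trans (leq_addl _ _).
rewrite wE ?inE ?eqxx ?orbT // value_zero_point.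
move: iNc fB; rewrite /content !wE ?inE ?eqxx ?orbT // !value_zero_point.
case: ifPn => // iw _; case: ifPn => [_ /esym/proj0_neq //|Bw _].
rewrite ifN //; apply/hasPn => j jw /=; rewrite inE negb_or.
have := hasPn iw j jw; rewrite /= inE => ->.
by have := hasPn Bw j jw.
Qed.

Lemma reads_value w v : {in w &, injective (code W a w)} ->
    infix (map (code W a w) w) W ->
    f (letter_point W a w) = value v (letter_point W a w) ->
  reads w = (filter (mem w) v == w).
Proof.
by move=> w_inj w_W fE; rewrite /reads fE value_letter_point.
Qed.

(** The zero point of the complement of the content, where f has value 1, forces
    the letters of w into the content. *)
Lemma local_word x D : size D <= 12 -> exists w, [/\ w != [::],
  {subset w <= content}, f x = value w x & conforms content reads w D].
Proof.
move=> D12.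
pose B := [seq i <- enum 'I_n | ~~ content i].
have [L sizeL memL] : exists2 L, size L <= words_bound 12 6 &
    forall v, {subset v <= D} -> size v <= 6 -> v \in L.
  by exists (words D 6) => [|v]; [apply: size_words | apply: mem_words].
have [|w w0 wE] := @local_value (x :: zero_point W B ::
    [seq zero_point W [:: i] | i <- D] ++ [seq letter_point W a v | v <- L]).
  rewrite /= size_cat !size_map /locality addn2 !ltnS addnC.
  by rewrite leq_add.
exists w; split=> //.
- have := zero_point_noncontent (B := B); rewrite wE ?inE ?eqxx ?orbT //.
  rewrite value_zero_point; case: ifPn => [_ /(_ (filter_all _ _))|].
    by move/esym/proj0_neq.
  move=> /hasPn Bw _ i /Bw; rewrite /= mem_filter mem_enum andbT negbK.
  exact.
- by rewrite wE // mem_head.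
have zeroE i : i \in D -> content i = (i \in w).
  move=> iD; rewrite /content wE; last first.
    by rewrite !inE mem_cat (map_f (fun i => zero_point W [:: i]) iD) !orbT.
  rewrite value_zero_point; case: hasP => [[j jw]|iNw].
    by rewrite /= inE => /eqP <-; rewrite jw.
  apply/idP/idP => [/eqP/proj0_neq //|iw].
  by case: iNw; exists i; rewrite //= inE.
have letE v : {subset v <= D} -> size v <= 6 ->
    f (letter_point W a v) = value w (letter_point W a v).
  move=> vD v6; apply: wE; rewrite !inE mem_cat.
  by rewrite (map_f (letter_point W a) (memL _ vD v6)) !orbT.
have readsE v v' : v =i v' -> uniq (map (code W a v) v') ->
    map (code W a v) v = take (size v) W -> {subset v <= D} -> size v <= 6 ->
  reads v = (filter (mem v) w == v).
  move=> vE /uniq_map_inj v'_inj cE vD v6; apply: reads_value; last exact: letE.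
  - by move=> i j; rewrite !vE; apply: v'_inj.
  by rewrite cE infix_take.
have [[ab as_ at_] bs bt st] := uniq4 abst.
split=> //.
- move=> i iD; apply: (readsE _ [:: i]) => //; rewrite /code /= ?eqxx //.
  by move=> j; rewrite inE => /eqP->.
- move=> i j iD jD ij; apply: (readsE _ [:: i; j]) => //.
  + by rewrite /code /= !eqxx (negPf ij) /= inE as_.
  + by rewrite /code /= !eqxx (negPf ij).
  by move=> k; rewrite !inE => /orP[]/eqP->.
- move=> i j iD jD ij; apply: (readsE _ [:: i; j]).
  + by move=> k; rewrite !inE orbCA orbb orbC.
  + by rewrite /code /= !eqxx (negPf ij) /= inE as_.
  + by rewrite /code /= !eqxx (negPf ij).
  + by move=> k; rewrite !inE => /or3P[]/eqP->.
  by [].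
move=> x1 z1 x1D z1D x2 z2 x2D z2D; rewrite /= !inE !negb_or !andbT.
move=> /and3P[/and3P[/negPf n1 /negPf n2 /negPf n3]].
move=> /andP[/negPf n4 /negPf n5] /negPf n6.
apply: (readsE _ [:: x1; z1; x2; z2]).
- move=> k; rewrite !inE.
  by case: (k == x1); case: (k == z1); case: (k == x2); case: (k == z2).
- rewrite /code /= !(eqxx, n1, n2, n3, n4, n5, n6) /= !inE !negb_or.
  by rewrite ab as_ at_ bt st eq_sym bs.
- by rewrite /code /= !(eqxx, n1, n2, n3, n4, n5, n6).
- by move=> k; rewrite !inE => /or4P[||| /or3P[]] /eqP->.
by [].
Qed.

Let local_conforms D : size D <= 12 -> exists w, conforms content reads w D.
Proof.
by case/(local_word [tuple proj [::] | i < n]) => w [_ _ _ w_D]; exists w.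
Qed.

Lemma content_regular i : linear reads i || separated reads i -> content i.
Proof.
move=> i_ok; have [//|w w_D] := @local_conforms [:: i; separator reads i].
have iD : i \in [:: i; separator reads i] by rewrite mem_head.
have wD : separator reads i \in [:: i; separator reads i].
  by rewrite !inE eqxx orbT.
have cnt0 := conforms_regular_token w_D iD wD i_ok 0.
have -> : content i = (i \in w) by case: w_D => ->.
by rewrite -has_pred1 has_count -cnt0 /regular_token /= !andbT.
Qed.

Definition irregular := [seq i <- enum 'I_n |
  content i && ~~ (linear reads i || separated reads i)].

(** A letter that occurs three times annihilates unless it is sent to 1. *)
Definition full_word := glued_word reads ++ irregular ++ irregular ++ irregular.

Lemma mem_full_word i : (i \in full_word) = content i.
Proof.
rewrite !mem_cat !orbb mem_filter mem_enum andbT.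
rewrite -has_pred1 has_count (count_glued_word local_conforms).
rewrite /regular_token /= andbT.
have := @content_regular i; case: (linear reads i) => /= [->//|].
by rewrite andbT; case: (separated reads i) => [->//|]; rewrite andbT.
Qed.

Lemma nonzero_value x v : value v x != None ->
    {in v, forall i, tnth x i != proj [::]} ->
  {in v, forall i, letters x i != [::]} /\ infix (flatten (map (letters x) v)) W.
Proof.
rewrite /value; case: allP => // v0 neq0 v1; split=> [i iv|].
  by apply: contra (v1 i iv) => /eqP xi0; rewrite [tnth x i]proj_letters ?xi0 ?v0.
by apply: contraR neq0 => Ninf; rewrite /factor_proj insubN.
Qed.

(** With N the letters of the content whose value is not 1, either side can be
    nonzero only if N has at most six letters, all linear or separated. *)
Lemma full_word_value x : f x = value full_word x.
Proof.
pose N := [seq i <- enum 'I_n | content i && (tnth x i != proj [::])].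
have N_uniq : uniq N by rewrite filter_uniq ?enum_uniq.
have memN i : (i \in N) = content i && (tnth x i != proj [::]).
  by rewrite mem_filter mem_enum andbT.
have [N_le|N_gt] := leqP (size N) 6; last first.
  (* Seven letters of N are enough to make a word vanish. *)
  have short v N' : uniq N' -> {subset N' <= N} -> 6 < size N' ->
      {subset N' <= v} -> value v x = None.
    move=> N'_uniq N'N N'6 N'v; apply/eqP; apply: contraLR N'6 => v0.
    rewrite -leqNgt; apply: (value_size v0) => // i /N'N.
    by rewrite memN => /andP[].
  have [|w [_ _ -> w_D]] := @local_word x (take 7 N).
    by rewrite size_takel.
  have taken : {subset take 7 N <= N} by move=> i /mem_take.
  rewrite (short w (take 7 N)) ?take_uniq ?size_takel //.
    by rewrite (short full_word N) // => i; rewrite mem_full_word memN => /andP[].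
  move=> i iN; case: w_D => <- // _ _ _ _.
  by have := taken i iN; rewrite memN => /andP[].
pose D := N ++ map (separator reads) N.
have [|w [_ wc -> w_D]] := @local_word x D.
  by rewrite size_cat size_map (leq_add N_le N_le).
have valueN v : {subset v <= content} -> value v x = value (filter (mem N) v) x.
  move=> vc; apply: value_filter => i /vc ic; rewrite /= memN.
  by rewrite -topredE /= in ic; rewrite ic /= negbK => /eqP.
rewrite valueN // [RHS]valueN => [|i]; last by rewrite mem_full_word.
have nonid v : {in filter (mem N) v, forall i, tnth x i != proj [::]}.
  by move=> i; rewrite mem_filter /= memN => /andP[/andP[]].
have structure v v_neq0 := @nonzero_value x (filter (mem N) v) v_neq0 (nonid v).
have ND i : i \in N -> i \in D by rewrite mem_cat => ->.
have wD i : i \in N -> separator reads i \in D.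
  by move=> iN; rewrite mem_cat map_f ?orbT.
have [/allP N_ok|] :=
  boolP (all (fun i => linear reads i || separated reads i) N).
  have -> : filter (mem N) full_word = filter (mem N) (glued_word reads).
    rewrite filter_cat [X in _ ++ X](_ : _ = [::]) ?cats0 //.
    apply/eqP; rewrite -(negbK (_ == _)) -has_filter; apply/hasPn => i.
    rewrite !mem_cat !orbb mem_filter => /andP[/andP[_ iNok] _] /=.
    by apply: contra iNok => /N_ok.
  have N_D : {in N, forall i, [&& i \in D, separator reads i \in D &
      linear reads i || separated reads i]}.
    by move=> i iN; rewrite ND ?wD ?N_ok.
  have eq_words := conforms_glued local_conforms w_D N_D.
  have [w0|w_neq0] := eqVneq (value (filter (mem N) w) x) None.
    have [u0|u_neq0] :=
      eqVneq (value (filter (mem N) (glued_word reads)) x) None.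
      by rewrite w0 u0.
    have [u_l u_inf] := structure _ u_neq0.
    by rewrite eq_words // (visible_in_tokens abst u_l u_inf) orbT.
  have [w_l w_inf] := structure _ w_neq0.
  by rewrite eq_words // (visible_in_tokens abst w_l w_inf).
(* A letter i of N that is neither linear nor separated makes both sides 0: a
   local word that does not vanish contains i once or twice, and then i is
   linear or has a separator. *)
case/allPn=> i iN i_bad; have ic : content i by move: iN; rewrite memN => /andP[].
have iirr : i \in irregular by rewrite mem_filter ic i_bad mem_enum.
have -> : value (filter (mem N) full_word) x = None.
  apply/eqP; apply: contraT => /structure[u_l u_inf].
  have := factor_count_le2 abst u_l u_inf i.
  rewrite count_mem_filter // !count_cat; move: iirr.
  by rewrite -has_pred1 has_count; clear; lia.
apply/eqP; apply: contraT => w_neq0; have [w_l w_inf] := structure _ w_neq0.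
have := factor_count_le2 abst w_l w_inf i; have iw : i \in w.
  by case: w_D => <- //; apply: ND.
have cnt_i : count_mem i (filter (mem N) w) = count_mem i w.
  by rewrite count_mem_filter.
move: i_bad; rewrite negb_or (conforms_linear w_D) ?ND // => /andP[cnt1 nspread].
rewrite leq_eqVlt cnt_i ltnS leq_eqVlt (negPf cnt1) ltnS leqn0 => cnt2.
have {}cnt2 : count_mem i w = 2.
  by case/predU1P: cnt2 => //= /eqP/count_memPn; rewrite iw.
have [z [q [zi cnt_z wE]]] := factor_twice abst w_l w_inf (etrans cnt_i cnt2).
case/negP: nspread; apply/existsP; exists z.
have zN : z \in N.
  have : z \in filter (mem N) w by rewrite -has_pred1 has_count cnt_z.
  by rewrite mem_filter => /andP[].
rewrite /between eq_sym zi /=; case: w_D => _ _ _ + _ => ->;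
  rewrite ?ND // 1?eq_sym //.
have -> : filter (mem [:: i; z; i]) w =
          filter (mem [:: i; z; i]) (filter (mem N) w).
  rewrite -filter_predI; apply: eq_filter => j /=.
  by rewrite !inE; apply/idP/andP => [/or3P[]/eqP-> | []//]; rewrite ?eqxx ?orbT.
have iz : (i == z) = false by rewrite eq_sym (negPf zi).
have [iq zq] : count_mem i q = 0 /\ count_mem z q = 0.
  move: cnt_i cnt_z; rewrite cnt2; case: wE => ->;
    rewrite ?count_cat /= !eqxx (negPf zi) iz; clear; lia.
have q_nil : filter (mem [:: i; z; i]) q = [::].
  apply/eqP; rewrite -(negbK (_ == _)) -has_filter; apply/hasPn => j jq /=.
  rewrite !inE; apply/negP => /or3P[]/eqP jE; subst j;
    by [move/count_memPn: iq; rewrite jq | move/count_memPn: zq; rewrite jq].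
have keep : filter (mem [:: i; z; i]) [:: i; z; i] = [:: i; z; i].
  by apply/all_filterP/allP.
by case: wE => ->; rewrite -?[i :: z :: i :: q]/([:: i; z; i] ++ q) filter_cat
  q_nil keep ?cats0.
Qed.

Lemma local_term_function : term_function f.
Proof.
have [//|w [w0 wc _ _]] := @local_word [tuple proj [::] | i < n] [::].
case uE: full_word => [|i u].
  case: w w0 wc => // i w _ /(_ i (mem_head _ _)).
  by rewrite -topredE /= -mem_full_word uE.
by exists i, u => x; rewrite full_word_value uE word_eval_value.
Qed.
End Main.

Theorem theorem6p7 (T : choiceType) (a b s t : T) :
  uniq [:: a; b; s; t] ->
  finitely_related (factor_monoid [:: a; s; a; b; t; b]).
Proof.
move=> abst; set W := [:: a; s; a; b; t; b].
pose e : seq (factor_monoid W) := None ::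
  [seq factor_proj W (take j (drop i W)) | i <- iota 0 7, j <- iota 0 7].
apply: (@local_finitely_related _ e locality) => [[[u uW]|]|n f n_gt0 f_local].
- rewrite inE; apply/orP; right.
  rewrite (_ : Some _ = factor_proj W u); last first.
    exact/esym/(factor_proj_val (exist _ u uW)).
  apply/allpairsP.
  have [A [B WE]] := infixP uW; exists (size A, size u).
  have : size A + (size u + size B) = 6 by rewrite -!size_cat -WE.
  rewrite !mem_iota WE drop_size_cat // take_size_cat //= => sz.
  by split=> //; lia.
- exact: mem_head.
exact: local_term_function abst n f f_local.
Qed.
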